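(* Let $E_\tau:\mathcal W\to\mathbb R$ be the smoothed energy $$E_\tau(W)=\sum_{i\in\mathcal V}\langle\theta_i,W_i\rangle+\sum_{ij\in\mathcal E}d_{\theta_{ij},\tau}(W_i,W_j)$$ on the assignment manifold $\mathcal W$, assumed to be differentiable, let $H(W)=-\langle W,\log W\rangle=-\sum_{i,k}W_{i,k}\log W_{i,k}$ be the entropy of the assignment matrix, let $h>0$, $\alpha\ge 0$, $\alpha_h=\alpha/h$, and define $$f_{\tau,\alpha}(W)=E_\tau(W)+\alpha_hH(W),\qquad W\in\mathcal W.$$ Then the sequence of updates $$W_i^{(k+1)}=\frac{(W_i^{(k)})^{1+\alpha}\cdot e^{-h\nabla_iE_\tau(W^{(k)})}}{\big\langle(W_i^{(k)})^{1+\alpha},e^{-h\nabla_iE_\tau(W^{(k)})}\big\rangle},\quad i\in[m],\qquad W^{(0)}=\tfrac1n\mathbf 1_m\mathbf 1_n^\top,$$ consists of geometric Euler steps of step size $h$ for numerically integrating the Riemannian gradient descent flow $\dot W(t)=-\nabla_{\mathcal W}f_{\tau,\alpha}(W(t))$ of $f_{\tau,\alpha}$; that is, $W^{(k)}=L_C(V^{(k)})$ for all $k\ge 0$, where $V^{(k)}\in T^m$ is given by $V^{(0)}=0$ and $V^{(k+1)}=V^{(k)}-h\nabla f_{\tau,\alpha}\big(L_C(V^{(k)})\big)$.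
   Context: $\mathbf 1_n=(1,\dots,1)^\top\in\mathbb R^n$. $\mathcal S=\{q\in\mathbb R^n:q_i>0,\ \langle\mathbf 1_n,q\rangle=1\}$, $T=\{v\in\mathbb R^n:\langle\mathbf 1_n,v\rangle=0\}$. The assignment manifold is $\mathcal W=\{W\in\mathbb R^{m\times n}:W_{ij}>0,\ W\mathbf 1_n=\mathbf 1_m\}$ with constant tangent space $T^m=\{V\in\mathbb R^{m\times n}:V\mathbf 1_n=0\}$ and the Fisher–Rao product metric $\langle U,V\rangle_W=\sum_{i,k}U_{i,k}V_{i,k}/W_{i,k}$; $W_i$ is the $i$-th row of $W$. $\nabla_{\mathcal W}$ is the Riemannian gradient. $\nabla J(W)\in T^m$ denotes the Euclidean gradient of a differentiable $J:\mathcal W\to\mathbb R$, i.e. the unique element of $T^m$ with $\langle\nabla J(W),X\rangle=DJ(W)[X]$ for all $X\in T^m$ (Frobenius inner product), and $\nabla_iJ(W)$ is its $i$-th row. Powers, exponentials, logarithms and the product $\cdot$ of vectors are componentwise. With the barycenter $C=\frac1n\mathbf 1_m\mathbf 1_n^\top$, the lifting map $L_C:T^m\to\mathcal W$ is the diffeomorphism given row-wise by $(L_C(V))_i=L_c(V_i)=\dfrac{c\cdot e^{V_i}}{\langle c,e^{V_i}\rangle}$, $c=\frac1n\mathbf 1_n$. Geometric Euler scheme: equip $T^m$ with the pullback under $L_C$ of the Fisher–Rao metric; the Riemannian gradient of $J\circ L_C$ at $V$ is then $\nabla J(L_C(V))$, so that the flow $\dot W=-\nabla_{\mathcal W}J(W)$,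 $W(0)=C$, corresponds via $W(t)=L_C(V(t))$ to $\dot V=-\nabla J(L_C(V))$, $V(0)=0$. The geometric Euler scheme with step size $h$ is the explicit Euler method $V^{(k+1)}=V^{(k)}-h\nabla J(L_C(V^{(k)}))$, $V^{(0)}=0$, on $T^m$, lifted to $\mathcal W$ by $W^{(k)}=L_C(V^{(k)})$. In $E_\tau$: $\mathcal G=(\mathcal V,\mathcal E)$ is a finite graph with $\mathcal V=[m]$ and a fixed orientation of each edge, $\theta_i\in\mathbb R^n$, $\theta_{ij}\in\mathbb R^{n\times n}$, $\tau>0$, and $d_{\Theta,\tau}(\mu_1,\mu_2)=\min\{\langle\Theta,M\rangle+F_\tau(M): M\in\mathbb R_+^{n\times n},\ M\mathbf 1_n=\mu_1,\ M^\top\mathbf 1_n=\mu_2\}$ with a fixed proper, lower semicontinuous, convex smoothing function $F_\tau$. *)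

(* Defs.v *)
From HB Require Import structures.
From mathcomp Require Import all_boot all_order all_algebra.
From mathcomp Require Import all_classical all_reals all_analysis.

Set Implicit Arguments.
Unset Strict Implicit.
Unset Printing Implicit Defensive.

Import Order.TTheory GRing.Theory Num.Theory.
Import numFieldNormedType.Exports.

Local Open Scope classical_set_scope.
Local Open Scope ring_scope.

(* Vectors of R^n are row vectors, so that the rows of an assignment matrix
   are vectors without transposition. *)

Definition dot (R : realType) (m n : nat) (A B : 'M[R]_(m, n)) : R :=
  \sum_i \sum_j A i j * B i j.

Definition assignment_manifold (R : realType) (m n : nat)
    : set 'M[R]_(m, n) :=
  [set W : 'M[R]_(m, n) | (forall i j, 0 < W i j) /\
            W *m (const_mx 1 : 'cV_n) = const_mx 1].

Definition tangent_space (R : realType) (m n : nat) : set 'M[R]_(m, n) :=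
  [set V : 'M[R]_(m, n) | V *m (const_mx 1 : 'cV_n) = 0].

Definition barycenter (R : realType) (m n : nat) : 'M[R]_(m, n) :=
  const_mx n%:R^-1.

(* p . e^v / <p, e^v> *)
Definition lifting (R : realType) (n : nat) (p v : 'rV[R]_n) : 'rV[R]_n :=
  (dot p (map_mx expR v))^-1 *: map2_mx *%R p (map_mx expR v).

Definition lifting_barycenter (R : realType) (m n : nat) (V : 'M[R]_(m, n))
    : 'M[R]_(m, n) :=
  \matrix_(i < m) lifting (const_mx n%:R^-1) (row i V).

(* Frechet differential at W along the tangent space.  The manifold is open in
   W + tangent_space, so only values of J on the manifold matter here; J
   determines L on the tangent space, not on all matrices. *)
Definition is_differential (R : realType) (m n : nat)
    (J : 'M[R]_(m, n) -> R) (W : 'M[R]_(m, n))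
    (L : {linear 'M[R]_(m, n) -> R^o}) : Prop :=
  forall eps : R, 0 < eps ->
    \forall X \near (0 : 'M[R]_(m, n)), tangent_space X ->
      `|J (W + X) - J W - L X| <= eps * `|X|.

Definition differentiable_on_manifold (R : realType) (m n : nat)
    (J : 'M[R]_(m, n) -> R) : Prop :=
  forall W, assignment_manifold W -> exists L, is_differential J W L.

Definition is_gradient (R : realType) (m n : nat) (J : 'M[R]_(m, n) -> R)
    (W G : 'M[R]_(m, n)) : Prop :=
  tangent_space G /\
  exists2 L, is_differential J W L &
    forall X, tangent_space X -> dot G X = L X.

(* There is exactly one gradient wherever J is differentiable; the value 0 is
   returned elsewhere. *)
Definition gradient (R : realType) (m n : nat) (J : 'M[R]_(m, n) -> R)
    (W : 'M[R]_(m, n)) : 'M[R]_(m, n) :=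
  xget 0 [set G | is_gradient J W G].

Definition geometric_euler_tangent (R : realType) (m n : nat)
    (J : 'M[R]_(m, n) -> R) (h : R) (k : nat) : 'M[R]_(m, n) :=
  iter k (fun V => V - h *: gradient J (lifting_barycenter V)) 0.

Definition geometric_euler (R : realType) (m n : nat)
    (J : 'M[R]_(m, n) -> R) (h : R) (k : nat) : 'M[R]_(m, n) :=
  lifting_barycenter (geometric_euler_tangent J h k).

Definition entropy (R : realType) (m n : nat) (W : 'M[R]_(m, n)) : R :=
  - dot W (map_mx (@ln R) W).

Definition proper_fun (R : realType) (T : Type) (F : T -> \bar R) : Prop :=
  (forall x, F x != -oo%E) /\ exists x, F x != +oo%E.

(* The library's [convex_function] is for real-valued functions.  Here
   0 * +oo = 0, so t = 0 and t = 1 impose nothing. *)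
Definition convex_efun (R : realType) (V : lmodType R) (F : V -> \bar R)
    : Prop :=
  forall (x y : V) (t : R), 0 <= t <= 1 ->
    (F (t *: x + (1 - t) *: y)%R <= t%:E * F x + (1 - t)%:E * F y)%E.

Definition couplings (R : realType) (n : nat) (mu1 mu2 : 'rV[R]_n)
    : set 'M[R]_n :=
  [set M : 'M[R]_n | [/\ forall i j, 0 <= M i j,
               M *m (const_mx 1 : 'cV_n) = mu1^T &
               M^T *m (const_mx 1 : 'cV_n) = mu2^T]].

(* For mu1, mu2 in the simplex the infimum is a minimum when F is proper
   and lower semicontinuous, the set of couplings being compact and nonempty. *)
Definition smoothed_distance (R : realType) (n : nat) (F : 'M[R]_n -> \bar R)
    (Theta : 'M[R]_n) (mu1 mu2 : 'rV[R]_n) : \bar R :=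
  ereal_inf [set ((dot Theta M)%:E + F M)%E | M in couplings mu1 mu2].

(* Each edge {i, j} is represented by exactly one of (i, j) and (j, i). *)
Definition oriented_edges (m : nat) (E : {set 'I_m * 'I_m}) : Prop :=
  forall i j, (i, j) \in E -> (j, i) \notin E.

Definition smoothed_energy (R : realType) (m n : nat)
    (E : {set 'I_m * 'I_m}) (theta : 'I_m -> 'rV[R]_n)
    (Theta : 'I_m -> 'I_m -> 'M[R]_n) (F : 'M[R]_n -> \bar R)
    (W : 'M[R]_(m, n)) : \bar R :=
  ((\sum_(i < m) dot (theta i) (row i W))%:E +
   \sum_(e in E)
     smoothed_distance F (Theta e.1 e.2) (row e.1 W) (row e.2 W))%E.

Definition regularized_energy (R : realType) (m n : nat)
    (J : 'M[R]_(m, n) -> R) (alpha_h : R) (W : 'M[R]_(m, n)) : R :=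
  J W + alpha_h * entropy W.

(* Main.v *)
(* On the tangent space the differential of the entropy at W is -<log W, .>,
   since constant rows are orthogonal to it.  For W = L_C(V) the rows of log W
   and V differ by constants, so the entropy has Euclidean gradient -V at L_C(V).
   The Euler step for f is therefore V |-> (1 + alpha) V - h grad E_tau(L_C(V)),
   and L_C maps it to the update, because lifting ignores the normalization of
   its base point and turns (L_c(v))^(1 + alpha) into c . e^((1 + alpha) v). *)

Require Import Defs.
From HB Require Import structures.
From mathcomp Require Import all_boot all_order all_algebra.
From mathcomp Require Import all_classical all_reals all_analysis.
From mathcomp Require Import ring.

Set Implicit Arguments.
Unset Strict Implicit.
Unset Printing Implicit Defensive.

Import Order.TTheory GRing.Theory Num.Theory.
Import numFieldNormedType.Exports.

Local Open Scope classical_set_scope.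
Local Open Scope ring_scope.

(** * Differentials and Euclidean gradients along the tangent space *)

Fact dot_is_linear (R : realType) (m n : nat) (A : 'M[R]_(m, n)) :
  linear (dot A : 'M[R]_(m, n) -> R^o).
Proof.
move=> a X Y; rewrite /dot scaler_sumr -big_split; apply: eq_bigr => i _ /=.
rewrite scaler_sumr -big_split; apply: eq_bigr => j _ /=.
by rewrite !mxE mulrDr mulrCA.
Qed.

(** Lets [dot G] itself serve as the linear map in [is_differential]. *)
HB.instance Definition _ (R : realType) (m n : nat) (A : 'M[R]_(m, n)) :=
  GRing.isLinear.Build R 'M[R]_(m, n) R^o *:%R (dot A) (dot_is_linear A).

Section Differentials.
Context {R : realType} {m n : nat}.
Implicit Types (A B G V W X : 'M[R]_(m, n)) (J : 'M[R]_(m, n) -> R).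

Lemma dotC A B : dot A B = dot B A.
Proof. by apply: eq_bigr => i _; apply: eq_bigr => j _; rewrite mulrC. Qed.

Lemma dot_eq0 A : dot A A = 0 -> A = 0.
Proof.
have sq_ge0 i j : 0 <= A i j * A i j by rewrite -expr2 sqr_ge0.
have row_ge0 i : 0 <= \sum_j A i j * A i j by apply: sumr_ge0.
move/eqP; rewrite psumr_eq0// => /allP A0; apply/matrixP => i j; rewrite mxE.
have := A0 i (mem_index_enum _); rewrite implyTb psumr_eq0// => /allP Ai0.
by have := Ai0 j (mem_index_enum _); rewrite implyTb mulf_eq0 orbb => /eqP.
Qed.

Lemma tangent_spaceP V : tangent_space V <-> forall i, \sum_j V i j = 0.
Proof.
have rowE i : (V *m (const_mx 1 : 'cV_n)) i 0 = \sum_j V i j.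
  by rewrite mxE; apply: eq_bigr => j _; rewrite mxE mulr1.
split=> [V0 i|V0]; first by rewrite -rowE V0 mxE.
by apply/matrixP => i j; rewrite ord1 rowE V0 mxE.
Qed.

Lemma tangent_spaceZD (a : R) X V :
  tangent_space X -> tangent_space V -> tangent_space (a *: X + V).
Proof.
by rewrite /tangent_space /= mulmxDl -scalemxAl => -> ->; rewrite scaler0 addr0.
Qed.

Lemma norm_entry_le X i j : `|X i j| <= `|X|.
Proof.
rewrite [leRHS]mx_normrE.
exact: (le_bigmax _ (fun ij : 'I_m * 'I_n => `|X ij.1 ij.2|) (i, j)).
Qed.

(** Along the line of multiples [k *: X], which stays tangent, both maps approximate the same
    increment of [J] up to o(k); dividing by [k] leaves a gap below any [e]. *)
Lemma differential_unique J W (L1 L2 : {linear 'M[R]_(m, n) -> R^o}) X :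
  is_differential J W L1 -> is_differential J W L2 ->
  tangent_space X -> L1 X = L2 X.
Proof.
move=> d1 d2 tX; apply/eqP; rewrite -subr_eq0 -normr_le0.
apply/ler_addgt0Pr => e e0; rewrite add0r.
(* Half of the tolerance goes to each differential; [1 + |X|] stays positive when [X = 0]. *)
have e'0 : 0 < e / 2 / (1 + `|X|) by rewrite !divr_gt0// ltr_pwDl.
(* The punctured neighbourhood provides [k != 0], so that [|k|] can be cancelled at the end. *)
near (0 : R)^' => k.
have k0 : k != 0 by near: k; exact: nbhs_dnbhs_neq.
have tkX : tangent_space (k *: X).
  by rewrite /tangent_space /= -scalemxAl tX scaler0.
have b1 : `|J (W + k *: X) - J W - L1 (k *: X)| <=
    e / 2 / (1 + `|X|) * `|k *: X|.
  by move: tkX; near: k; exact: nbhs_dnbhs (near0Z X (d1 _ e'0)).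
have b2 : `|J (W + k *: X) - J W - L2 (k *: X)| <=
    e / 2 / (1 + `|X|) * `|k *: X|.
  by move: tkX; near: k; exact: nbhs_dnbhs (near0Z X (d2 _ e'0)).
have : `|k| * `|L1 X - L2 X| <= `|k| * e.
  have -> : `|k| * `|L1 X - L2 X| = `|(J (W + k *: X) - J W - L2 (k *: X)) -
      (J (W + k *: X) - J W - L1 (k *: X))|.
    by rewrite !linearZ/= -normrM; congr (`| _ |); rewrite /GRing.scale/=; ring.
  apply: (le_trans (ler_normB _ _)); apply: (le_trans (lerD b2 b1)).
  have -> : e / 2 / (1 + `|X|) * `|k *: X| + e / 2 / (1 + `|X|) * `|k *: X| =
      `|k| * e * (`|X| / (1 + `|X|)).
    by rewrite normrZ; field; rewrite gt_eqF// ltr_pwDl.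
  rewrite -[leRHS]mulr1 ler_wpM2l ?mulr_ge0 ?(ltW e0)//.
  by rewrite ler_pdivrMr ?ltr_pwDl// mul1r lerDr.
by rewrite ler_pM2l// normr_gt0.
Unshelve. all: by end_near. Qed.

Lemma eq_is_differential J W (L1 L2 : {linear 'M[R]_(m, n) -> R^o}) :
  (forall X, tangent_space X -> L1 X = L2 X) ->
  is_differential J W L1 -> is_differential J W L2.
Proof.
by move=> eqL d e e0; apply: filterS (d e e0) => X + tX; rewrite -eqL//; apply.
Qed.

(** Differentials are tested on tangent vectors only, where [L] and [dot G] agree, so [L] can be
    replaced by [dot G]. *)
Lemma is_gradientP J W G :
  is_gradient J W G <-> tangent_space G /\ is_differential J W (dot G).
Proof.
split=> [[tG [L dL GL]]|[tG dG]]; split=> //; last by exists (dot G).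
by apply: eq_is_differential dL => X tX; exact/esym/GL.
Qed.

(** The difference of two gradients is itself tangent; testing both differentials on it shows that
    it is orthogonal to itself. *)
Lemma is_gradient_unique J W G1 G2 :
  is_gradient J W G1 -> is_gradient J W G2 -> G1 = G2.
Proof.
move=> /is_gradientP[t1 d1] /is_gradientP[t2 d2].
have tB : tangent_space (G1 - G2).
  by rewrite addrC -scaleN1r; exact: tangent_spaceZD.
apply/eqP; rewrite -subr_eq0; apply/eqP/dot_eq0.
by rewrite linearB/= !(dotC (G1 - G2)) (differential_unique d1 d2 tB) subrr.
Qed.

Lemma gradientE J W G : is_gradient J W G -> gradient J W = G.
Proof.
move=> gG; apply: xget_unique => // G' gG'.
exact: is_gradient_unique gG' gG.
Qed.

Lemma gradientP J W :
  (exists L, is_differential J W L) -> is_gradient J W (gradient J W).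
Proof.
move=> [L dL]; apply: (@xgetPex _ 0 [set G | is_gradient J W G]).
(* The entries of the witness are the coordinates of [L] in the basis [delta_mx], projected
   orthogonally onto the tangent space by subtracting from each row its mean [s i / n]. *)
pose s i := \sum_k L (delta_mx i k).
exists (\matrix_(i, j) (L (delta_mx i j) - n%:R^-1 * s i)); split.
  apply/tangent_spaceP => i; under eq_bigr do rewrite mxE.
  rewrite sumrB sumr_const card_ord /s.
  (* For [n = 0] both sums are empty. *)
  case: (posnP n) => [n0|n_gt0]; last first.
    by rewrite -mulrnAl -[_ *+ n]mulr_natr mulVf ?pnatr_eq0 -?lt0n// mul1r subrr.
  by rewrite big1 ?mulr0 ?mul0rn ?subrr// => -[j jn]; exfalso; rewrite n0 in jn.
exists L => // X /tangent_spaceP tX.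
rewrite [in RHS](matrix_sum_delta X) linear_sum; apply: eq_bigr => i _ /=.
(* The subtracted mean is constant along the row, hence invisible to [X], whose rows sum to 0. *)
under eq_bigr do rewrite mxE mulrBl.
rewrite sumrB -mulr_sumr tX mulr0 subr0 linear_sum; apply: eq_bigr => j _ /=.
by rewrite linearZ mulrC.
Qed.

Lemma is_gradientDZ J1 J2 (c : R) W G1 G2 :
  is_gradient J1 W G1 -> is_gradient J2 W G2 ->
  is_gradient (fun W => J1 W + c * J2 W) W (G1 + c *: G2).
Proof.
move=> /is_gradientP[t1 d1] /is_gradientP[t2 d2].
apply/is_gradientP; split; first by rewrite addrC; exact: tangent_spaceZD.
move=> e e0.
(* The two errors add up to [1 + |c|] times the common tolerance. *)
have c0 : 0 < 1 + `|c| by rewrite ltr_pwDl.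
have e'0 : 0 < e / (1 + `|c|) by rewrite divr_gt0.
apply: filterS2 (d1 _ e'0) (d2 _ e'0) => X b1 b2 tX.
move: (b1 tX) (b2 tX) => {}b1 {}b2.
have -> : J1 (W + X) + c * J2 (W + X) - (J1 W + c * J2 W) -
    dot (G1 + c *: G2) X =
    (J1 (W + X) - J1 W - dot G1 X) + c * (J2 (W + X) - J2 W - dot G2 X).
  have -> : dot (G1 + c *: G2) X = dot G1 X + c * dot G2 X.
    by rewrite dotC linearD linearZ/= !(dotC X).
  by ring.
apply: (le_trans (ler_normD _ _)); rewrite normrM.
apply: (le_trans (lerD b1 (ler_wpM2l (normr_ge0 c) b2))).
rewrite le_eqVlt; apply/orP; left; apply/eqP; field; exact: lt0r_neq0.
Qed.

End Differentials.

(** * First-order expansion of the entropy *)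

(** Multiplying the difference quotient by [|x|] gives a bound that also covers [x = 0]; this
    matters because single entries of a perturbation may vanish. *)
Lemma is_derive_approx (R : realType) (phi : R -> R) (w d eps : R) :
  is_derive w 1 phi d -> 0 < eps ->
  \forall x \near 0, `|phi (w + x) - phi w - d * x| <= eps * `|x|.
Proof.
move=> [dphi <-] e0.
have /cvgrPdist_le/(_ _ e0) : (h^-1 *: ((phi \o shift w) (h *: 1) - phi w))
  @[h --> 0^'] --> 'D_1 phi w by exact: dphi.
rewrite near_withinE; apply: filterS => x b.
have [->|x0] := eqVneq x 0.
  by rewrite addr0 subrr mulr0 subrr !normr0 mulr0.
move: (b x0); rewrite /shift/= [_ *: 1]mulr1 distrC => {}b.
rewrite -ler_pdivrMr ?normr_gt0// -normfV -normrM.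
apply: le_trans b; rewrite le_eqVlt; apply/orP; left; apply/eqP; congr (`| _ |).
rewrite /GRing.scale/= (addrC x); field; exact: x0.
Qed.

Lemma is_derive_xlnx (R : realType) (w : R) : 0 < w ->
  is_derive w 1 (fun x : R => x * ln x) (ln w + 1).
Proof.
move=> w0; have dln := is_derive1_ln w0.
have -> : ln w + 1 = w *: w^-1 + ln w *: 1 :> R.
  by rewrite /GRing.scale/= mulfV ?gt_eqF// mulr1 addrC.
exact: (@is_deriveM _ _ (fun x : R => x) (@ln R)).
Qed.

(** The entropy splits into functions of single entries, and finitely many entrywise expansions hold
    on a common neighbourhood. The representing matrix is not tangent in general; [entropy_gradient]
    exchanges it for a tangent one. *)
Lemma entropy_differential (R : realType) (m n : nat) (W : 'M[R]_(m, n)) :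
  (forall i j, 0 < W i j) ->
  is_differential (@entropy R m n) W (dot (\matrix_(i, j) - (ln (W i j) + 1))).
Proof.
move=> W0 e e0.
(* The tolerance is shared among the [m * n] entries; the extra 1 keeps the divisor positive when
   there are none. *)
have N0 : 0 < 1 + (m * n)%:R :> R by rewrite ltr_pwDl.
have e'0 : 0 < e / (1 + (m * n)%:R) by rewrite divr_gt0.
pose d (x : R) := ln x + 1; pose phi x : R := x * ln x.
have near_b (ij : 'I_m * 'I_n) : \forall X \near (0 : 'M[R]_(m, n)),
    `|phi (W ij.1 ij.2 + (X : 'M[R]_(m, n)) ij.1 ij.2) - phi (W ij.1 ij.2)
      - d (W ij.1 ij.2) * X ij.1 ij.2|
    <= e / (1 + (m * n)%:R) * `|X ij.1 ij.2|.
  have := is_derive_approx (is_derive_xlnx (W0 ij.1 ij.2)) e'0.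
  have := @coord_continuous R m n ij.1 ij.2 0.
  by rewrite /continuous_at mxE; exact.
apply: filterS (filter_forall _ near_b) => X b _.
have -> : entropy (W + X) - entropy W
    - dot (\matrix_(i, j) - (ln (W i j) + 1)) X =
    - \sum_i \sum_j (phi (W i j + X i j) - phi (W i j) - d (W i j) * X i j).
  under [in RHS]eq_bigr do rewrite !sumrB.
  rewrite !sumrB /entropy /dot !opprD !opprK; congr (- _ + _ + _).
  - by apply: eq_bigr => i _; apply: eq_bigr => j _; rewrite !mxE.
  - by apply: eq_bigr => i _; apply: eq_bigr => j _; rewrite !mxE.
  - rewrite -sumrN; apply: eq_bigr => i _; rewrite -sumrN; apply: eq_bigr => j _.
    by rewrite !mxE mulNr opprK.
rewrite normrN pair_big/=; apply: (le_trans (ler_norm_sum _ _ _)).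
have bX (ij : 'I_m * 'I_n) : true -> `|phi (W ij.1 ij.2 + X ij.1 ij.2)
    - phi (W ij.1 ij.2) - d (W ij.1 ij.2) * X ij.1 ij.2| <=
    e / (1 + (m * n)%:R) * `|X|.
  move=> _; apply: (le_trans (b ij)).
  by rewrite ler_wpM2l ?(ltW e'0)// norm_entry_le.
apply: (le_trans (ler_sum _ bX)).
rewrite sumr_const card_prod !card_ord -[_ *+ (m * n)]mulr_natr.
rewrite mulrAC ler_wpM2r// mulrAC ler_pdivrMr// ler_wpM2l ?(ltW e0)//.
by rewrite lerDr.
Qed.

(** * The lifting map at the barycenter *)

(** The factor [s] appears in the numerator and in the normalizing sum, and cancels. *)
Lemma lifting_eq (R : realType) (n : nat) (p q v w : 'rV[R]_n) (s : R) :
  s != 0 -> (forall j, p 0 j * expR (v 0 j) = s * (q 0 j * expR (w 0 j))) ->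
  lifting p v = lifting q w.
Proof.
move=> s0 pq; apply/rowP => j; rewrite !mxE pq.
have -> : dot p (map_mx expR v) = s * dot q (map_mx expR w).
  rewrite /dot mulr_sumr; apply: eq_bigr => i _; rewrite mulr_sumr.
  by apply: eq_bigr => k _; rewrite !mxE ord1 pq.
by rewrite invfM mulrACA mulVf// mul1r.
Qed.

Section Lifting.
Context {R : realType} {m n : nat} (n_gt0 : (0 < n)%N).
Implicit Types (v : 'rV[R]_n) (V : 'M[R]_(m, n)).

Let c : 'rV[R]_n := const_mx n%:R^-1.

Let n_inv_gt0 : 0 < n%:R^-1 :> R. Proof. by rewrite invr_gt0 ltr0n. Qed.

Lemma dot_barycenter_gt0 v : 0 < dot c (map_mx expR v).
Proof.
rewrite /dot big_ord1 (bigD1 (Ordinal n_gt0))//= ltr_pwDl//.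
  by rewrite !mxE mulr_gt0 ?expR_gt0.
by apply: sumr_ge0 => j _; rewrite !mxE mulr_ge0 ?expR_ge0 ?(ltW n_inv_gt0).
Qed.

Lemma lifting_barycenter_manifold V : assignment_manifold (lifting_barycenter V).
Proof.
have Z0 i := dot_barycenter_gt0 (row i V); split=> [i j|].
  by rewrite !mxE !mulr_gt0 ?expR_gt0 ?invr_gt0 ?ltr0n ?Z0.
apply/matrixP => i j; rewrite !mxE.
under eq_bigr do rewrite [const_mx _ _ _]mxE mulr1 mxE mxE.
rewrite -mulr_sumr -[RHS](mulVf (lt0r_neq0 (Z0 i))); congr (_ * _).
by rewrite /dot big_ord1; apply: eq_bigr => k _; rewrite !mxE.
Qed.

Lemma lifting_barycenter0 : lifting_barycenter 0 = barycenter R m n.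
Proof.
apply/matrixP => i j; rewrite !mxE /dot big_ord1.
under eq_bigr do rewrite !mxE expR0 mulr1.
rewrite sumr_const card_ord -[_ *+ n]mulr_natr mulVf ?pnatr_eq0 -?lt0n//.
by rewrite invr1 mul1r expR0 mulr1.
Qed.

(** The first summand does not depend on [j]: it is the row constant that tangent vectors
    annihilate. *)
Lemma ln_lifting_barycenter V i j :
  ln (lifting_barycenter V i j) =
  ln (n%:R^-1 / dot c (map_mx expR (row i V))) + V i j.
Proof.
have Z0 := dot_barycenter_gt0 (row i V).
have -> : lifting_barycenter V i j =
    n%:R^-1 / dot c (map_mx expR (row i V)) * expR (V i j).
  by rewrite !mxE mulrA [_^-1 * _]mulrC.
by rewrite lnM ?posrE ?expR_gt0 ?divr_gt0// expRK.
Qed.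

Lemma entropy_gradient V : tangent_space V ->
  is_gradient (@entropy R m n) (lifting_barycenter V) (- V).
Proof.
move=> tV; apply/is_gradientP; split.
  by rewrite /tangent_space /= mulNmx tV oppr0.
have [W0 _] := lifting_barycenter_manifold V.
apply: eq_is_differential (entropy_differential W0) => X /tangent_spaceP tX /=.
apply: eq_bigr => i _; apply/eqP; rewrite -subr_eq0 -sumrB.
(* [V] cancels in the difference of the two coefficients; what is left is constant along row [i] and
   factors out. *)
have -> : \sum_j ((\matrix_(i, j) - (ln (lifting_barycenter V i j) + 1)) i j
      * X i j - (- V) i j * X i j) =
    - (ln (n%:R^-1 / dot c (map_mx expR (row i V))) + 1) * \sum_j X i j.
  rewrite mulr_sumr; apply: eq_bigr => j _.
  by rewrite [(\matrix_(_, _) _) _ _]mxE ln_lifting_barycenter [(- V) _ _]mxE; ring.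
by rewrite tX mulr0.
Qed.

Lemma lifting_powR (a : R) v u :
  lifting (map_mx (fun x => x `^ a) (lifting c v)) u = lifting c (a *: v + u).
Proof.
have Z0 := dot_barycenter_gt0 v.
(* The power turns the normalizing factor of [lifting c v] into its [a]-th power; the factor [n]
   offsets the entry [n%:R^-1] of [c] on the other side. *)
apply: (@lifting_eq _ _ _ _ _ _ ((n%:R^-1 / dot c (map_mx expR v)) `^ a * n%:R)).
  by rewrite mulf_neq0 ?pnatr_eq0 -?lt0n// lt0r_neq0// powR_gt0// divr_gt0.
move=> j; rewrite !mxE.
have -> : (dot c (map_mx expR v))^-1 * (n%:R^-1 * expR (v 0 j)) =
    n%:R^-1 / dot c (map_mx expR v) * expR (v 0 j) by rewrite mulrA [_^-1 * _]mulrC.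
rewrite powRM ?expR_ge0 ?divr_ge0 ?(ltW Z0)// -expRM expRD [v 0 j * a]mulrC.
by field; rewrite pnatr_eq0 -lt0n.
Qed.

End Lifting.

(** * Induction over the Euler steps *)

Theorem proposition5p1 (R : realType) (m n : nat) (n_gt0 : (0 < n)%N)
    (edges : {set 'I_m * 'I_m}) (edges_oriented : oriented_edges edges)
    (theta : 'I_m -> 'rV[R]_n) (Theta : 'I_m -> 'I_m -> 'M[R]_n)
    (tau : R) (tau_gt0 : 0 < tau) (F : R -> 'M[R]_n -> \bar R)
    (F_proper : proper_fun (F tau))
    (F_lsc : lower_semicontinuous (F tau))
    (F_convex : convex_efun (F tau))
    (E_tau : 'M[R]_(m, n) -> R)
    (E_tauE : forall W, assignment_manifold W ->
       smoothed_energy edges theta Theta (F tau) W = (E_tau W)%:E)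
    (E_tau_diff : differentiable_on_manifold E_tau)
    (h alpha : R) (h_gt0 : 0 < h) (alpha_ge0 : 0 <= alpha)
    (W : nat -> 'M[R]_(m, n)) (W0 : W 0%N = @barycenter R m n)
    (W_update : forall (k : nat) (i : 'I_m),
       row i (W k.+1) =
         lifting (map_mx (fun x => x `^ (1 + alpha)) (row i (W k)))
              (- h *: row i (gradient E_tau (W k)))) :
  let f := regularized_energy E_tau (alpha / h) in
  forall k : nat,
    tangent_space (geometric_euler_tangent f h k) /\
    W k = geometric_euler f h k.
Proof.
(* Tangency is carried along in the induction because [- V] can be the gradient of the entropy only
   if [V] is tangent. *)
move=> f; elim=> [|k [tV WV]].
  split; first by rewrite /tangent_space /= mul0mx.
  by rewrite W0 /geometric_euler /= lifting_barycenter0.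
rewrite /geometric_euler /=; set V := geometric_euler_tangent f h k in tV WV *.
have mW := lifting_barycenter_manifold n_gt0 V.
have gE := gradientP (E_tau_diff _ mW).
have -> : gradient f (lifting_barycenter V) =
    gradient E_tau (lifting_barycenter V) + (alpha / h) *: - V.
  exact/gradientE/is_gradientDZ/entropy_gradient.
set G := gradient E_tau _ in gE *.
(* The step size cancels in [h * (alpha / h)], so the entropy contributes exactly [alpha *: V]. *)
have -> : V - h *: (G + (alpha / h) *: - V) = (1 + alpha) *: V + - h *: G.
  by apply/matrixP => i j; rewrite !mxE; field; exact: lt0r_neq0.
split.
  apply: tangent_spaceZD => //; rewrite -[_ *: G]addr0.
  by apply: tangent_spaceZD; [case: gE|rewrite /tangent_space /= mul0mx].
apply/row_matrixP => i; rewrite W_update /geometric_euler -/V rowK.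
by rewrite WV /geometric_euler -/V rowK lifting_powR// linearD !linearZ.
Qed.
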